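(* Let $G$ be a compact topological group. Then any free transitive distributive binary $G$-space is biequimorphic to the binary $G$-space $(G,G,\eta)$ with the binary action $\eta : G\times G\times G\to G$ given by $$\eta(g,g_1,g_2)=g_1 g g_1^{-1} g_2 \qquad \text{for all } g,g_1,g_2\in G.$$
   Context: All maps are assumed continuous. A binary action of a topological group $G$ on a topological space $X$ is a continuous map $\mu : G\times X\times X\to X$, written $\mu(g,x,y)=g(x,y)$, such that $gh(x,y)=g(x,h(x,y))$ and $e(x,y)=y$ for all $g,h\in G$, $x,y\in X$, where $e$ is the identity of $G$. The triple $(G,X,\mu)$ (or just $X$) is then called a binary $G$-space. A binary $G$-space $X$ is distributive if $g(h(x,x'),h(x,x''))=h(x,g(x',x''))$ for all $x,x',x''\in X$ and $g,h\in G$. For $x\in X$ put $G(x,x)=\{g(x,x) : g\in G\}$. A subset $A\subset X$ is bi-invariant if $G(A,A)=\{g(a_1,a_2): g\in G,\ a_1,a_2\in A\}$ equals $A$; the orbit $[x]$ of $x \in X$ is the minimal bi-invariant subset of $X$ containing $x$. A binary $G$-space $X$ is transitive if $G(x,x)=X$ for every $x\in X$, i.e. there is precisely one orbit, $X$ itself (in particular $X$ is nonempty). A binary $G$-space $X$ is free if for every $x\in X$ the stationary (isotropy) subgroup $G_{(x,x)}=\{g\in G : g(x,x)=x\}$ is trivial. A continuous map $\varphi : X\to Y$ between binary $G$-spaces is biequivariant if $\varphi(g(x,x'))=g(\varphi(x),\varphi(x'))$ for all $g\in G$, $x,x'\in X$. A biequimorphism is a biequivariant homeomorphism with biequivariant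 inverse; two binary $G$-spaces are biequimorphic if there is a biequimorphism between them.
   Formalization: The binary G-space X is additionally assumed to be Hausdorff; without this the claim fails, e.g. for G = Z/2 discrete acting on X = Z/2 with the indiscrete topology by g(x,y) = gy. *)

(* Defs.v *)
From HB Require Import structures.
From mathcomp Require Import all_boot.
From mathcomp Require Import all_classical topology.

Set Implicit Arguments.
Unset Strict Implicit.
Unset Printing Implicit Defensive.

Local Open Scope classical_set_scope.
Local Open Scope group_scope.

(* No separation axiom is imposed on the topology. *)
HB.mixin Record Group_isTopologicalGroup G & Topological G & Group G := {
  mulg_continuous : continuous (fun p : G * G => p.1 * p.2) ;
  invg_continuous : continuous (fun x : G => x^-1) ;
}.

#[short(type="topologicalGroupType")]
HB.structure Definition TopologicalGroup :=
  {G of Topological G & Group G & Group_isTopologicalGroup G}.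

(* A binary G-space (G, X, mu) is represented by a [mu : binary_action G X]. *)
Record binary_action (G : topologicalGroupType) (X : topologicalType) :=
  BinaryAction {
    binact :> G -> X -> X -> X ;
    binact_continuous :
      continuous (fun p : G * X * X => binact p.1.1 p.1.2 p.2) ;
    binactM : forall (g h : G) (x y : X),
      binact (g * h) x y = binact g x (binact h x y) ;
    binact1 : forall x y : X, binact 1 x y = y
  }.

Section BinaryGSpaces.
Context {G : topologicalGroupType}.

Definition binary_distributive {X : topologicalType} (mu : binary_action G X) :=
  forall (g h : G) (x x' x'' : X),
    mu g (mu h x x') (mu h x x'') = mu h x (mu g x' x'').

(* The nonemptiness clause excludes the empty space, which has no orbit. *)
Definition binary_transitive {X : topologicalType} (mu : binary_action G X) :=
  [set: X] !=set0 /\ forall x : X, [set mu g x x | g in [set: G]] = [set: X].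

Definition isotropy {X : topologicalType} (mu : binary_action G X) (x : X)
  : set G := [set g | mu g x x = x].

Definition binary_free {X : topologicalType} (mu : binary_action G X) :=
  forall x : X, isotropy mu x = [set 1].

Definition biequivariant {X Y : topologicalType}
    (mu : binary_action G X) (nu : binary_action G Y) (f : X -> Y) :=
  continuous f /\
  forall (g : G) (x x' : X), f (mu g x x') = nu g (f x) (f x').

Definition biequimorphic {X Y : topologicalType}
    (mu : binary_action G X) (nu : binary_action G Y) :=
  exists (f : X -> Y) (f' : Y -> X),
    [/\ cancel f f', cancel f' f, biequivariant mu nu f
      & biequivariant nu mu f'].

End BinaryGSpaces.

Section Eta.
Context (G : topologicalGroupType).

Definition eta_fun (g g1 g2 : G) : G := g1 * g * g1^-1 * g2.

Lemma eta_fun_continuous :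
  continuous (fun p : G * G * G => eta_fun p.1.1 p.1.2 p.2).
Proof.
have contM (f h : G * G * G -> G) :
    continuous f -> continuous h -> continuous (fun p => f p * h p).
  move=> cf ch p.
  apply: (@continuous2_cvg _ _ _ _ _ _ f h (fun x y : G => x * y)).
  - exact: (mulg_continuous (f p, h p)).
  - exact: cf.
  - exact: ch.
have c11 : continuous (fun p : G * G * G => p.1.1).
  by move=> p; apply: (@cvg_comp _ _ _ fst fst _ (nbhs p.1)); exact: cvg_fst.
have c12 : continuous (fun p : G * G * G => p.1.2).
  by move=> p; apply: (@cvg_comp _ _ _ fst snd _ (nbhs p.1));
    [exact: cvg_fst | exact: cvg_snd].
have c2 : continuous (fun p : G * G * G => p.2) by move=> p; exact: cvg_snd.
apply: (contM) => //; apply: (contM); first exact: contM.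
move=> p; apply: (@continuous_comp _ _ _ (fun p => p.1.2) (fun x : G => x^-1)).
  exact: c12.
exact: invg_continuous.
Qed.

Lemma eta_funM (g h x y : G) :
  eta_fun (g * h) x y = eta_fun g x (eta_fun h x y).
Proof. by rewrite /eta_fun -!mulgA mulKg. Qed.

Lemma eta_fun1 (x y : G) : eta_fun 1 x y = y.
Proof. by rewrite /eta_fun mulg1 mulgV mul1g. Qed.

Definition eta_action : binary_action G G :=
  BinaryAction eta_fun_continuous eta_funM eta_fun1.

End Eta.

(* Main.v *)
Require Import Defs.
From mathcomp Require Import all_boot.
From mathcomp Require Import all_classical topology.

Local Open Scope classical_set_scope.

(** Fix a base point [x0].  The orbit map [g |-> g(x0, x0)] from [G] to [X] is
    continuous, onto by transitivity and one-to-one by freeness; [G] being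
    compact and [X] Hausdorff, it is a homeomorphism
    ([continuous_inverse_compact_hausdorff]).  Distributivity says that the
    translation [h(x0, -)] carries the operation [g(x0, -)] to the operation
    [g(h(x0, x0), -)].  Hence the latter is the conjugate of [g(x0, -)] by
    [h(x0, -)], namely [(h * g * h^-1)(x0, -)]
    ([binary_distributive_conj]).  Transported along the orbit map, this is the
    formula for [eta]. *)

(** The inverse pulls a closed set of [X] back to its image under [f], which is
    compact and therefore closed. *)
Lemma continuous_inverse_compact_hausdorff (X Y : topologicalType)
    (f : X -> Y) (f' : Y -> X) :
  compact [set: X] -> hausdorff_space Y -> continuous f ->
  cancel f f' -> cancel f' f -> continuous f'.
Proof.
move=> cX hY cf fK f'K; apply/continuous_closedP => A clA.
have -> : f' @^-1` A = f @` A.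
  apply/seteqP; split=> [y Ay|_ [x Ax <-]]; last by rewrite /preimage /= fK.
  by exists (f' y).
apply: compact_closed => //; apply: continuous_compact.
  exact: continuous_subspaceT.
exact: (subclosed_compact clA cX).
Qed.

Section OrbitMap.
Variables (G : topologicalGroupType) (X : topologicalType).
Variable mu : binary_action G X.

Lemma orbit_map_continuous (x : X) : continuous (fun g => mu g x x).
Proof.
move=> g; apply: (@continuous_comp _ _ _ (fun g : G => (g, x, x))
  (fun p : G * X * X => mu p.1.1 p.1.2 p.2)); last exact: binact_continuous.
have cst_x : cst x @ g --> x by exact: cst_continuous.
have pair_x : (fun g : G => (g, x)) @ g --> (g, x).
  exact: (@cvg_pair _ _ _ (nbhs g) (nbhs g) (nbhs x) _ _ _ id (cst x)).
exact: (@cvg_pair _ _ _ (nbhs g) (nbhs (g, x)) (nbhs x) _ _ _ _ (cst x)).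
Qed.

Lemma orbit_map_inj (x : X) : binary_free mu -> injective (fun g => mu g x x).
Proof.
move=> mu_free g h /= gh.
have : isotropy mu x (h^-1 * g)%g.
  by rewrite /isotropy /= binactM gh -binactM mulVg binact1.
by rewrite mu_free => /= hg; rewrite -[g](mulVKg h) hg mulg1.
Qed.

Lemma binary_distributive_conj (x y : X) (g h : G) : binary_distributive mu ->
  mu g (mu h x x) y = mu (h * g * h^-1)%g x y.
Proof.
move=> mu_distr.
(* The second argument must have the form [h(x, _)] for distributivity. *)
have {1}-> : y = mu h x (mu (h^-1)%g x y) by rewrite -binactM mulgV binact1.
by rewrite mu_distr -!binactM.
Qed.

End OrbitMap.

Theorem theorem2 (G : topologicalGroupType) (hG : compact [set: G])
    (X : topologicalType) (hX : hausdorff_space X) (mu : binary_action G X)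
    (mu_free : binary_free mu) (mu_trans : binary_transitive mu)
    (mu_distr : binary_distributive mu) :
  biequimorphic mu (eta_action G).
Proof.
case: mu_trans => -[x0 _] mu_onto.
pose phi (g : G) := mu g x0 x0.
have /choice[psi psiK] : forall x, exists g, phi g = x.
  move=> x; have : [set: X] x by [].
  by rewrite -(mu_onto x0) => -[g _ gx]; exists g.
have phiK : cancel phi psi.
  by move=> g; apply: (orbit_map_inj _ _ mu x0 mu_free); exact: psiK.
have phi_cont : continuous phi by exact: orbit_map_continuous.
have phiE g g1 g2 : phi (eta_action G g g1 g2) = mu g (phi g1) (phi g2).
  by rewrite /phi binary_distributive_conj // -binactM.
exists psi, phi; split => //; split => //.
  exact: (continuous_inverse_compact_hausdorff _ _ phi).
by move=> g x x'; apply: (can_inj phiK); rewrite phiE !psiK.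
Qed.
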